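(* Let $\alpha$ be a constant positive integer, and let the task weights $w_1,\dots,w_n$ take values in a set $\{w'_1,\dots,w'_\alpha\}$. Given resource delays $d_1\le d_2\le\dots\le d_m$, an optimal (lowest-cost) assignment of the $n$ tasks to the $m$ resources may be found in time $O(mn^{2\alpha})$.
   Context: A problem instance $(T,R)$ consists of a set $R=\{1,\dots,m\}$ of resources with delays (positive reals) $d_1\le\dots\le d_m$ and a set $T=\{1,\dots,n\}$ of tasks with real weights $w_1,\dots,w_n\ge 1$. An assignment is a vector $A=(A_1,\dots,A_n)\in\{1,\dots,m\}^n$ (task $i$ is assigned to resource $A_i$). The load of resource $\ell$ in $A$ is $L(\ell,A)=d_\ell\sum_{i\in T:\,A_i=\ell}w_i$, and the social cost is $C(A)=\sum_{i\in T}L(A_i,A)$. An optimal assignment is one minimizing $C$ over all assignments. Running time counts elementary arithmetic operations and comparisons; the constant hidden in $O(\cdot)$ may depend on the constant $\alpha$. *)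

(* Defs.v *)
From mathcomp Require Import all_boot all_order all_algebra reals.

Set Implicit Arguments.
Unset Strict Implicit.
Unset Printing Implicit Defensive.

Import Order.TTheory GRing.Theory Num.Theory.
Local Open Scope ring_scope.

(* Tasks are 'I_n, resources are 'I_m (numbered from 0), [w] are the task
   weights and [d] the resource delays. *)
Section Instance.
Variables (R : realType) (n m : nat) (w : 'I_n -> R) (d : 'I_m -> R).

Definition assignment := {ffun 'I_n -> 'I_m}.

Definition load (l : 'I_m) (A : assignment) : R :=
  d l * \sum_(i < n | A i == l) w i.

Definition social_cost (A : assignment) : R :=
  \sum_(i < n) load (A i) A.

Definition optimal (A : assignment) : Prop :=
  forall B : assignment, social_cost A <= social_cost B.

End Instance.

(* A uniform unit-cost real RAM, presented as a structured language.  The memory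
   consists of countably many unbounded arrays of naturals and countably many
   unbounded arrays of reals.  The array names occurring in a program are fixed,
   so a program uses finitely many arrays; indices are computed at run time.
   Naturals can be converted to reals, but there is no floor or other map from
   reals to naturals: a real influences the control flow and the natural memory
   only through comparisons.  The only literals are naturals, so a program
   cannot hide information in real constants. *)

Inductive nexp : Type :=
| NConst of nat
| NGet of nat & nexp              (* array name, index *)
| NAdd of nexp & nexp
| NSub of nexp & nexp             (* truncated *)
| NMul of nexp & nexp.

Inductive rexp : Type :=
| ROfN of nexp
| RGet of nat & nexp              (* array name, index *)
| RAdd of rexp & rexp
| RSub of rexp & rexp
| RMul of rexp & rexp
| RDiv of rexp & rexp.            (* x / 0 is 0 *)

Inductive test : Type :=
| TNlt of nexp & nexp
| TNeq of nexp & nexp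
| TRlt of rexp & rexp
| TReq of rexp & rexp
| TNot of test
| TAnd of test & test.

Inductive cmd : Type :=
| Skip
| SetN of nat & nexp & nexp       (* array name, index, value *)
| SetR of nat & nexp & rexp       (* array name, index, value *)
| Seq of cmd & cmd
| If of test & cmd & cmd
| While of test & cmd.

(* Every literal, memory access, conversion, arithmetic operation, comparison
   and boolean connective costs one unit, and so does every control step, so the
   running time bounds the number of arithmetic operations and comparisons. *)

Fixpoint ncost (e : nexp) : nat :=
  match e with
  | NConst _ => 1
  | NGet _ i => (ncost i).+1
  | NAdd e1 e2 | NSub e1 e2 | NMul e1 e2 => (ncost e1 + ncost e2).+1
  end.

Fixpoint rcost (e : rexp) : nat :=
  match e with
  | ROfN k => (ncost k).+1
  | RGet _ i => (ncost i).+1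
  | RAdd e1 e2 | RSub e1 e2 | RMul e1 e2 | RDiv e1 e2 =>
      (rcost e1 + rcost e2).+1
  end.

Fixpoint tcost (b : test) : nat :=
  match b with
  | TNlt e1 e2 | TNeq e1 e2 => (ncost e1 + ncost e2).+1
  | TRlt e1 e2 | TReq e1 e2 => (rcost e1 + rcost e2).+1
  | TNot b1 => (tcost b1).+1
  | TAnd b1 b2 => (tcost b1 + tcost b2).+1
  end.

Record state (R : Type) : Type := State {
  nmem : nat -> nat -> nat;       (* array name, index *)
  rmem : nat -> nat -> R
}.

Definition upd (V : Type) (mem : nat -> nat -> V) (a i : nat) (v : V) :
    nat -> nat -> V :=
  fun b j => if (b == a) && (j == i) then v else mem b j.

Section Semantics.
Variable R : realType.
Implicit Types s : state R.

Fixpoint neval s (e : nexp) : nat :=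
  match e with
  | NConst k => k
  | NGet a i => nmem s a (neval s i)
  | NAdd e1 e2 => (neval s e1 + neval s e2)%N
  | NSub e1 e2 => (neval s e1 - neval s e2)%N
  | NMul e1 e2 => (neval s e1 * neval s e2)%N
  end.

Fixpoint reval s (e : rexp) : R :=
  match e with
  | ROfN k => (neval s k)%:R
  | RGet a i => rmem s a (neval s i)
  | RAdd e1 e2 => reval s e1 + reval s e2
  | RSub e1 e2 => reval s e1 - reval s e2
  | RMul e1 e2 => reval s e1 * reval s e2
  | RDiv e1 e2 => reval s e1 / reval s e2
  end.

Fixpoint teval s (b : test) : bool :=
  match b with
  | TNlt e1 e2 => (neval s e1 < neval s e2)%N
  | TNeq e1 e2 => neval s e1 == neval s e2
  | TRlt e1 e2 => reval s e1 < reval s e2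
  | TReq e1 e2 => reval s e1 == reval s e2
  | TNot b1 => ~~ teval s b1
  | TAnd b1 b2 => teval s b1 && teval s b2
  end.

Definition setn s (a i v : nat) : state R :=
  State (upd (nmem s) a i v) (rmem s).

Definition setr s (a i : nat) (v : R) : state R :=
  State (nmem s) (upd (rmem s) a i v).

(* [exec c s s' t]: started in [s], [c] halts in [s'] at total cost [t]. *)
Inductive exec : cmd -> state R -> state R -> nat -> Prop :=
| exec_skip s :
    exec Skip s s 1
| exec_setn a i e s :
    exec (SetN a i e) s (setn s a (neval s i) (neval s e))
      (ncost i + ncost e).+1
| exec_setr a i e s :
    exec (SetR a i e) s (setr s a (neval s i) (reval s e))
      (ncost i + rcost e).+1
| exec_seq c1 c2 s s1 s2 t1 t2 :
    exec c1 s s1 t1 -> exec c2 s1 s2 t2 ->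
    exec (Seq c1 c2) s s2 (t1 + t2)
| exec_if b c1 c2 s s1 t :
    exec (if teval s b then c1 else c2) s s1 t ->
    exec (If b c1 c2) s s1 (tcost b + t).+1
| exec_while_false b c s :
    ~~ teval s b ->
    exec (While b c) s s (tcost b).+1
| exec_while_true b c s s1 s2 t1 t2 :
    teval s b -> exec c s s1 t1 -> exec (While b c) s1 s2 t2 ->
    exec (While b c) s s2 (tcost b + t1 + t2).+1.

Lemma exec_det c s s1 s2 t1 t2 :
  exec c s s1 t1 -> exec c s s2 t2 -> s1 = s2 /\ t1 = t2.
Proof.
move=> E; elim: E s2 t2 => {c s s1 t1}
  [s|a i e s|a i e s|c1 c2 s s1 s1' t1 t1' _ IH1 _ IH2|b c1 c2 s s1 t _ IH
  |b c s /negP Hb|b c s s1 s1' t1 t1' Hb _ IH1 _ IH2] s2 t2 E;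
  inversion E as [ | | |? ? ? u ? ? ? E1 E2|? ? ? ? ? ? E1|? ? ? Nb
                 |? ? ? u ? ? ? Tb E1 E2]; subst => //.
- by have [? ?] := IH1 _ _ E1; subst; have [-> ->] := IH2 _ _ E2.
- by have [-> ->] := IH _ _ E1.
- by rewrite Hb in Nb.
- by have [? ?] := IH1 _ _ E1; subst; have [-> ->] := IH2 _ _ E2.
Qed.

Definition vec_mem (k : nat) (x : 'I_k -> R) (i : nat) : R :=
  if insub i is Some j then x j else 0.

(* Natural array 0 holds n and m, real array 0 the weights, real array 1 the
   delays; the rest of the memory is zero. *)
Definition input (n m : nat) (w : 'I_n -> R) (d : 'I_m -> R) : state R :=
  State
    (fun a i => if a == 0 then nth 0 [:: n; m] i else 0)%N
    (fun a i => match a with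
                | 0%N => vec_mem w i
                | 1%N => vec_mem d i
                | _ => 0
                end).

(* The assignment is read off natural array 1. *)
Definition outputs (n m : nat) (s : state R) (A : assignment n m) : Prop :=
  forall i : 'I_n, nmem s 1 i = A i :> nat.

End Semantics.

(* Main.v *)
(* A dynamic program over the resources.  Since only the number of tasks of each
   weight matters, a set of tasks is coded in base n + 1, the j-th digit counting
   the tasks of the j-th distinct weight; there are at most (n + 1) ^ alpha codes.
   The cost of giving a group of tasks to a resource depends only on the code of
   the group.  The optimal cost of serving the code c with the resources 0..l is
   the minimum, over the codes x digitwise below c, of the cost of giving x to l
   plus the optimal cost of c - x with the resources 0..l-1.  This takes
   m (n + 1) ^ (2 alpha) steps; an optimal assignment is then read off backwards,
   the tasks of each group being picked greedily. *)

Require Import Defs.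
From mathcomp Require Import all_boot all_order all_algebra reals.
From mathcomp Require Import zify.

Set Implicit Arguments.
Unset Strict Implicit.
Unset Printing Implicit Defensive.

Import Order.TTheory GRing.Theory Num.Theory.
Local Open Scope ring_scope.

(** The machine has no division of naturals, so the digits of a code cannot be read off in one step.
    The type of a task is therefore stored as the power of [n + 1] itself, and groups are handled
    only by adding, subtracting and comparing codes and by table lookups. The innermost step has to
    take constant time, including the test that [x] lies digitwise below [c]; tabulated digit sums
    of [c - x], [x] and [c] decide it. These tables grow by one digit whenever a new weight is met,
    so the number of distinct weights is discovered at run time and one program serves every
    [alpha]. Optimality needs no optimal-value function: the last table entry bounds the cost of
    every assignment from below, and the assignment read off backwards costs exactly that entry. *)

(** * A program logic for total correctness with time budgets *)

Section CostLogic.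
Local Open Scope nat_scope.
Variable R : realType.
Implicit Types (s : state R) (c : cmd).

(** The existential asserts termination; as [exec] is deterministic, it describes the only run. *)
Definition wp c s (b : nat) (Q : state R -> Prop) : Prop :=
  exists s' t, [/\ exec c s s' t, t <= b & Q s'].

Lemma wp_seq c1 c2 s b1 b2 b (Q1 Q : state R -> Prop) :
  wp c1 s b1 Q1 -> (forall s1, Q1 s1 -> wp c2 s1 b2 Q) -> b1 + b2 <= b ->
  wp (Seq c1 c2) s b Q.
Proof.
move=> [s1 [t1 [E1 l1 q1]]] H hb; have [s2 [t2 [E2 l2 q2]]] := H _ q1.
exists s2, (t1 + t2); split=> //; first exact: exec_seq E1 E2.
exact: leq_trans (leq_add l1 l2) hb.
Qed.

Lemma wp_if tst c1 c2 s b b' (Q : state R -> Prop) :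
  (teval s tst -> wp c1 s b Q) -> (~~ teval s tst -> wp c2 s b Q) ->
  (tcost tst + b).+1 <= b' -> wp (If tst c1 c2) s b' Q.
Proof.
move=> H1 H2 hb.
have [s' [t [E l q]]] : wp (if teval s tst then c1 else c2) s b Q.
  by case: ifP => [/H1|/negbT /H2].
exists s', (tcost tst + t).+1; split=> //; first exact: exec_if.
by apply: leq_trans hb; rewrite ltnS leq_add2l.
Qed.

Fixpoint loop_free c : bool :=
  match c with
  | Seq c1 c2 | If _ c1 c2 => loop_free c1 && loop_free c2
  | While _ _ => false
  | _ => true
  end.

(** Straight-line code is verified by computing its final state. The values of [den] and [max_cost]
    on loops are dummies, screened off by [loop_free]. *)
Fixpoint den c s : state R :=
  match c with
  | SetN a i e => setn s a (neval s i) (neval s e)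
  | SetR a i e => setr s a (neval s i) (reval s e)
  | Seq c1 c2 => den c2 (den c1 s)
  | If b c1 c2 => if teval s b then den c1 s else den c2 s
  | _ => s
  end.

Fixpoint max_cost c : nat :=
  match c with
  | Skip => 1
  | SetN a i e => (ncost i + ncost e).+1
  | SetR a i e => (ncost i + rcost e).+1
  | Seq c1 c2 => max_cost c1 + max_cost c2
  | If b c1 c2 => (tcost b + maxn (max_cost c1) (max_cost c2)).+1
  | While _ _ => 0
  end.

Lemma wp_loop_free c s b (Q : state R -> Prop) :
  loop_free c -> max_cost c <= b -> Q (den c s) -> wp c s b Q.
Proof.
suff: loop_free c -> wp c s (max_cost c) (eq (den c s)).
  move=> H /H [s' [t [E l e]]] hb q; exists s', t; split; rewrite -?e //.
  - by rewrite e.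
  - exact: leq_trans l hb.
elim: c s => [|a i e|a i e|c1 IH1 c2 IH2|t c1 IH1 c2 IH2|//] s /=.
- by exists s, 1; split=> //; exact: exec_skip.
- by exists (setn s a (neval s i) (neval s e)), (ncost i + ncost e).+1; split=> //; exact: exec_setn.
- by exists (setr s a (neval s i) (reval s e)), (ncost i + rcost e).+1; split=> //; exact: exec_setr.
- move=> /andP[/(IH1 s) H1 /IH2 H2]; apply: wp_seq H1 _ (leqnn _) => s1 <-.
  exact: H2.
move=> /andP[/(IH1 s) H1 /(IH2 s) H2].
apply: (@wp_if _ _ _ _ (maxn (max_cost c1) (max_cost c2))) => // T.
  rewrite T; have [s' [u [E l q]]] := H1; exists s', u; split=> //.
  by rewrite leq_max l.
rewrite (negbTE T); have [s' [u [E l q]]] := H2; exists s', u; split=> //.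
by rewrite leq_max l orbT.
Qed.

Fixpoint nwrites c : seq nat :=
  match c with
  | SetN a _ _ => [:: a]
  | Seq c1 c2 | If _ c1 c2 => nwrites c1 ++ nwrites c2
  | While _ c1 => nwrites c1
  | _ => [::]
  end.

Fixpoint rwrites c : seq nat :=
  match c with
  | SetR a _ _ => [:: a]
  | Seq c1 c2 | If _ c1 c2 => rwrites c1 ++ rwrites c2
  | While _ c1 => rwrites c1
  | _ => [::]
  end.

(** The granularity is a whole array, so preservation reduces to a membership test on a literal
    list. *)
Definition frame c s s' : Prop :=
  (forall a i, a \notin nwrites c -> nmem s' a i = nmem s a i) /\
  (forall a i, a \notin rwrites c -> rmem s' a i = rmem s a i).

Lemma exec_frame c s s' t : exec c s s' t -> frame c s s'.
Proof.
elim=> {c s s' t}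
  [s|a i e s|a i e s|c1 c2 s s1 s2 t1 t2 _ [n1 r1] _ [n2 r2]|b c1 c2 s s1 t _ [n1 r1]
  |b c s _|b c s s1 s2 t1 t2 _ _ [n1 r1] _ [n2 r2]]; split=> a' j /=.
all: rewrite ?inE ?mem_cat ?negb_or //.
- by move=> /negbTE na; rewrite /upd na.
- by move=> /negbTE na; rewrite /upd na.
- by move=> /andP[h1 h2]; rewrite n2 // n1.
- by move=> /andP[h1 h2]; rewrite r2 // r1.
- by move=> /andP[h1 h2]; apply: n1; case: ifP.
- by move=> /andP[h1 h2]; apply: r1; case: ifP.
- by move=> h; rewrite n2 // n1.
- by move=> h; rewrite r2 // r1.
Qed.

Lemma wp_seq_frame c1 c2 s b1 b2 b (Q1 Q : state R -> Prop) :
  wp c1 s b1 Q1 ->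
  (forall s1, frame c1 s s1 -> Q1 s1 -> wp c2 s1 b2 Q) -> b1 + b2 <= b ->
  wp (Seq c1 c2) s b Q.
Proof.
move=> [s1 [t1 [E1 l1 q1]]] H.
apply: (@wp_seq _ _ _ _ _ _ (fun s1 => frame c1 s s1 /\ Q1 s1)) => [|s2 [f2 q2]].
  by exists s1, t1; split=> //; split=> //; exact: exec_frame E1.
exact: H.
Qed.

Lemma wp_step c1 c2 s b1 b2 b (Q : state R -> Prop) :
  loop_free c1 -> max_cost c1 <= b1 -> wp c2 (den c1 s) b2 Q -> b1 + b2 <= b ->
  wp (Seq c1 c2) s b Q.
Proof.
move=> lf mc H; apply: (@wp_seq _ _ _ _ _ _ (eq (den c1 s))) => [|s1 <- //].
exact: wp_loop_free.
Qed.

(** Each scalar occupies cell 0 of an array of its own, so that [frame] can separate scalars from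
    one another. *)
Definition Var a := NGet a (NConst 0).

Definition For a lo hi body :=
  Seq (SetN a (NConst 0) lo)
    (While (TNlt (Var a) hi)
       (Seq body (SetN a (NConst 0) (NAdd (Var a) (NConst 1))))).

(** The invariant takes the counter value as an argument, and [stab] makes it insensitive to the
    counter cell, which the increment overwrites. Facts about memory that the loop does not write
    come from [frame] with respect to the initial state. Per iteration the test costs
    [ncost hi + 3], the increment 6 and the [While] step 1, whence the 10. *)
Lemma wp_for a lo hi body s L H b b' (Inv : nat -> state R -> Prop)
    (Q : state R -> Prop) :
  neval s lo = L -> L <= H ->
  a \notin nwrites body ->
  (forall s', frame (For a lo hi body) s s' -> neval s' hi = H) ->
  (forall k s' v, Inv k s' -> Inv k (setn s' a 0 v)) ->
  Inv L s ->
  (forall k s', L <= k < H -> frame (For a lo hi body) s s' ->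
     nmem s' a 0 = k -> Inv k s' -> wp body s' b (Inv k.+1)) ->
  (forall s', frame (For a lo hi body) s s' -> Inv H s' -> Q s') ->
  (H - L) * (b + ncost hi + 10) + (ncost lo + ncost hi + 10) <= b' ->
  wp (For a lo hi body) s b' Q.
Proof.
move=> eL LH na ehi stab I0 step fin hb.
set Q' := fun s' => frame (For a lo hi body) s s' /\ Inv H s'.
suff {fin} [s' [t [E l [fr I]]]]: wp (For a lo hi body) s b' Q'.
  by exists s', t; split=> //; exact: fin.
pose tc := tcost (TNlt (Var a) hi).
pose lp := While (TNlt (Var a) hi)
       (Seq body (SetN a (NConst 0) (NAdd (Var a) (NConst 1)))).
have frW s' s'' : frame (For a lo hi body) s s' -> frame lp s' s'' ->
    frame (For a lo hi body) s s''.
  move=> [n1 r1] [n2 r2]; split=> a' j h; rewrite ?n2 ?n1 ?r2 ?r1 //.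
  by move: h; rewrite /= in_cons negb_or => /andP[_].
have main k s' : L <= k <= H -> frame (For a lo hi body) s s' ->
    nmem s' a 0 = k -> Inv k s' ->
    wp lp s' ((H - k) * (b + ncost hi + 10) + (ncost hi + 4)) Q'.
  move e: (H - k) => dd; elim: dd k s' e => [|dd IH] k s' e /andP[Lk kH] fr ka Ik.
    have kE : k = H by lia.
    exists s', tc.+1; split.
    - by apply: exec_while_false; rewrite /= ka (ehi _ fr) kE ltnn.
    - by rewrite /tc /=; lia.
    - by split=> //; rewrite -kE.
  have kH' : L <= k < H by lia.
  have [s1 [t1 [E1 l1 I1]]] := step _ _ kH' fr ka Ik.
  have [fn1 fr1] := exec_frame E1.
  have sa1 : nmem s1 a 0 = k by rewrite fn1.
  pose s2 := setn s1 a 0 k.+1.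
  have E2 : exec (Seq body (SetN a (NConst 0) (NAdd (Var a) (NConst 1)))) s' s2
       (t1 + 6).
    apply: exec_seq E1 _.
    have := exec_setn a (NConst 0) (NAdd (Var a) (NConst 1)) s1.
    by rewrite /= sa1 addn1.
  have frs2 : frame lp s' s2 by exact: exec_frame E2.
  have [||||s3 [t3 [E3 l3 q3]]] := IH k.+1 s2 _ _ (frW _ _ fr frs2).
  - by lia.
  - by lia.
  - by rewrite /s2 /= /upd !eqxx.
  - exact: stab.
  exists s3, (tc + (t1 + 6) + t3).+1; split=> //.
    by apply: exec_while_true E2 E3; rewrite /= ka (ehi _ fr); case/andP: kH'.
  by rewrite /tc /= mulSn; lia.
have fr0 : frame (For a lo hi body) s (setn s a 0 L).
  split=> a' j //=; rewrite /upd in_cons negb_or => /andP[/negbTE -> _] //.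
have [||s' [t [E l q]]] := main L (setn s a 0 L) _ fr0 _ (stab _ _ _ I0).
- by rewrite leqnn.
- by rewrite /= /upd !eqxx.
exists s', ((1 + ncost lo).+1 + t); split=> //.
  apply: exec_seq E; rewrite -eL; exact: exec_setn.
by apply: leq_trans hb; lia.
Qed.

End CostLogic.

(** * Digits in base [B], carries and the digitwise order *)

Section Digits.
Local Open Scope nat_scope.
Variable B : nat.
Hypothesis B_gt1 : 1 < B.

Definition digit c j := (c %/ B ^ j) %% B.
Definition digit_sum K c := \sum_(j < K) digit c j.
Definition digitwise_le K x y := forall j, j < K -> digit x j <= digit y j.
Definition from_digits K (v : nat -> nat) := \sum_(j < K) v j * B ^ j.

Let B_gt0 : 0 < B. Proof. exact: ltnW. Qed.

Lemma digit_ltB c j : digit c j < B.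
Proof. by rewrite /digit ltn_mod. Qed.

Lemma digit0 c : digit c 0 = c %% B.
Proof. by rewrite /digit expn0 divn1. Qed.

Lemma digitS c j : digit c j.+1 = digit (c %/ B) j.
Proof. by rewrite /digit expnS divnMA. Qed.

Lemma from_digitsS K v :
  from_digits K.+1 v = v 0 + B * from_digits K (fun j => v j.+1).
Proof.
rewrite /from_digits big_ord_recl expn0 muln1 big_distrr /=; congr (_ + _).
by apply: eq_bigr => i _; rewrite /bump leq0n add1n expnS mulnCA.
Qed.

Lemma digit_sumS K c : digit_sum K.+1 c = c %% B + digit_sum K (c %/ B).
Proof.
rewrite /digit_sum big_ord_recl digit0; congr (_ + _).
by apply: eq_bigr => i _; rewrite lift0 digitS.
Qed.

Lemma from_digitsK K c : c < B ^ K -> from_digits K (digit c) = c.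
Proof.
elim: K c => [|K IH] c; first by rewrite /from_digits big_ord0 expn0; lia.
rewrite expnS => h; rewrite from_digitsS digit0.
rewrite /from_digits (eq_bigr (fun j : 'I_K => digit (c %/ B) j * B ^ j)).
  by rewrite -/(from_digits K (digit _)) IH 1?mulnC 1?addnC -?divn_eq // ltn_divLR // mulnC.
by move=> i _; rewrite digitS.
Qed.

Lemma digit_from_digits K v j :
  (forall j, j < K -> v j < B) -> j < K -> digit (from_digits K v) j = v j.
Proof.
elim: K v j => [//|K IH] v [|j] hv hj; rewrite from_digitsS.
  by rewrite digit0 mulnC addnC modnMDl modn_small // hv.
rewrite digitS mulnC addnC divnMDl // divn_small ?hv // addn0.
by rewrite (IH (fun j => v j.+1)) // => i hi; exact: hv.
Qed.

Lemma from_digits_lt K v : (forall j, j < K -> v j < B) -> from_digits K v < B ^ K.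
Proof.
elim: K v => [|K IH] v hv; first by rewrite /from_digits big_ord0.
rewrite from_digitsS expnS.
have h := IH (fun j => v j.+1) (fun j hj => hv j.+1 hj).
have h0 := hv 0 isT.
have : B * (from_digits K (fun j => v j.+1)).+1 <= B * B ^ K by rewrite leq_mul2l h orbT.
by rewrite mulnS; lia.
Qed.

Lemma from_digitsD K u v :
  from_digits K (fun j => u j + v j) = from_digits K u + from_digits K v.
Proof. by rewrite /from_digits -big_split; apply: eq_bigr => i _; rewrite mulnDl. Qed.

(* Every carry lowers the digit sum by [B - 1]. *)
Lemma digit_sum_from_digits K v :
  digit_sum K (from_digits K v) <= \sum_(j < K) v j /\
  (digit_sum K (from_digits K v) = \sum_(j < K) v j ->
   forall j, j < K -> v j < B).
Proof.
elim: K v => [|K IH] v; first by rewrite /digit_sum !big_ord0.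
rewrite digit_sumS from_digitsS [B * _]mulnC [v 0 + _]addnC modnMDl divnMDl //.
have -> : \sum_(j < K.+1) v j = v 0 + \sum_(j < K) v j.+1.
  by rewrite big_ord_recl; congr (_ + _); apply: eq_bigr => j _; rewrite lift0.
set q := v 0 %/ B; have hq : v 0 = q * B + v 0 %% B by exact: divn_eq.
case: K IH => [|K] IH.
  rewrite /digit_sum !big_ord0 !addn0; split; first exact: leq_mod.
  by move=> e [|j] // _; rewrite -e ltn_mod.
(* The carry [q] out of position 0 moves to the next position. It removes [q * B] units and adds
   back [q]; since [B > 1], equality of the sums forces [q = 0]. *)
pose v' j := if j == 0 then v 1 + q else v j.+1.
have e1 : from_digits K.+1 (fun j => v j.+1) + q = from_digits K.+1 v'.
  by rewrite !from_digitsS /v' /=; lia.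
have e2 : \sum_(j < K.+1) v' j = \sum_(j < K.+1) v j.+1 + q.
  by rewrite big_ord_recl [in RHS]big_ord_recl addnAC.
have [h1 h2] := IH v'; rewrite e1.
have hqB : q + q <= q * B by rewrite -{1}[q]muln1 -{2}[q]muln1 -mulnDr leq_mul2l B_gt1 orbT.
have hr : v 0 %% B < B by rewrite ltn_mod.
move: h1 h2 hq hr; rewrite {}e2; clear e1 IH; clearbody q.
move: (v 0 %% B) (digit_sum _ _) (\sum_(j < _) v _) => r S S' h1 h2 hq hr.
split; first lia.
move=> e.
have q0 : q = 0 by lia.
have {}h2 : forall j, j < K.+1 -> v' j < B by apply: h2; lia.
case=> [|j] hj; first by rewrite hq q0.
by have := h2 j hj; rewrite /v'; case: eqP => [->|//]; rewrite q0 addn0.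
Qed.

(** Forward, the digitwise sum of [y - x] and [x] evaluates to [y], and equality of the digit sums
    excludes carries, so its entries are the digits of [y]. Backward, the digitwise differences are
    the digits of [y - x], since nothing is borrowed. *)
Lemma digitwise_leP K x y : y < B ^ K ->
  reflect (digitwise_le K x y /\ x < B ^ K)
    ((x <= y) && (digit_sum K (y - x) + digit_sum K x == digit_sum K y)).
Proof.
move=> hy; apply: (iffP andP) => [[xy /eqP e]|[le hx]].
  have hx : x < B ^ K by lia.
  have hyx : y - x < B ^ K by lia.
  split=> //.
  pose v j := digit (y - x) j + digit x j.
  have ev : from_digits K v = y by rewrite from_digitsD !from_digitsK //; lia.
  have [_ h] := digit_sum_from_digits K v.
  have {}h : forall j, j < K -> v j < B.
    by apply: h; rewrite ev -e /digit_sum -big_split.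
  by move=> j hj; rewrite -ev digit_from_digits // leq_addl.
pose v j := digit y j - digit x j.
have ev : from_digits K v + x = y.
  rewrite -{1}[x](from_digitsK hx) -from_digitsD -[RHS](from_digitsK hy).
  by apply: eq_bigr => j _; rewrite /v subnK // le.
have hv j : j < K -> v j < B by move=> _; rewrite /v; have := digit_ltB y j; lia.
split; first by lia.
have -> : y - x = from_digits K v by lia.
rewrite /digit_sum -big_split; apply/eqP; apply: eq_bigr => j _ /=.
by rewrite digit_from_digits // /v subnK // le.
Qed.

Lemma digit_sub K x y j : y < B ^ K -> digitwise_le K x y -> x < B ^ K -> j < K ->
  digit (y - x) j = digit y j - digit x j.
Proof.
move=> hy le hx hj.
pose v j := digit y j - digit x j.
have ev : from_digits K v + x = y.
  rewrite -{1}[x](from_digitsK hx) -from_digitsD -[RHS](from_digitsK hy).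
  by apply: eq_bigr => i _; rewrite /v subnK // le.
have -> : y - x = from_digits K v by lia.
by rewrite digit_from_digits // => i _; rewrite /v; have := digit_ltB y i; lia.
Qed.

Lemma digit_addX_lt K c j : j < K -> digit (c + B ^ K) j = digit c j.
Proof.
move=> hj; rewrite /digit -(subnK hj) expnD divnDr; last first.
  by rewrite expnS mulnA dvdn_mull.
by rewrite expnS mulnA mulnK ?expn_gt0 ?B_gt0 // addnC modnMDl.
Qed.

Lemma digit_addX_eq K c : c + B ^ K < B ^ K.+1 -> digit (c + B ^ K) K = (digit c K).+1.
Proof.
move=> h; rewrite /digit divnDr // divnn expn_gt0 B_gt0 /= addn1.
have h1 : (c %/ B ^ K).+1 < B.
  have : (c + B ^ K) %/ B ^ K < B by rewrite ltn_divLR ?expn_gt0 ?B_gt0 // -expnS.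
  by rewrite divnDr // divnn expn_gt0 B_gt0 addn1.
by rewrite !modn_small // ltnW.
Qed.

Lemma digit_small K c : c < B ^ K -> digit c K = 0.
Proof. by move=> h; rewrite /digit divn_small // mod0n. Qed.

Lemma digit_zero j : digit 0 j = 0.
Proof. by rewrite /digit div0n mod0n. Qed.

Lemma digitX K k j : k < K -> j < K -> digit (B ^ k) j = (j == k).
Proof.
move=> hk hj.
have -> : B ^ k = from_digits K (fun i => (i == k) : nat).
  rewrite /from_digits (bigD1 (Ordinal hk)) //= eqxx mul1n big1 ?addn0 // => i.
  by rewrite -val_eqE /= => /negbTE ->.
by rewrite digit_from_digits // => i _; case: (i == k) => //; exact: B_gt0.
Qed.

End Digits.

(** * Codes of sets of tasks, and costs as functions of codes *)

Section Coding.
Variables (R : realType) (n K : nat) (ty : nat -> nat) (v : nat -> R) (dv : nat -> R).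
Hypothesis n_gt0 : (0 < n)%N.
Hypothesis ty_lt : forall i, (i < n)%N -> (ty i < K)%N.
Notation B := n.+1.
Let B_gt1 : (1 < B)%N. Proof. by []. Qed.

(** As a sum of powers, the code is additive over disjoint sets of tasks. No digit overflows,
    because a count of at most [n] tasks is below the base [n + 1]. *)
Definition code (P : pred nat) : nat := (\sum_(i < n | P i) B ^ ty i)%N.

Definition digit_val (c : nat) : R := \sum_(j < K) (digit B c j)%:R * v j.

(** All tasks on resource [l] pay the same load, the delay times the total weight [digit_val]; the
    factor [digit_sum] is the number of tasks that pay it. *)
Definition group_cost (l x : nat) : R :=
  dv l * ((digit_sum B K x)%:R * digit_val x).

Lemma eq_code (P Q : pred nat) :
  (forall i, (i < n)%N -> P i = Q i) -> code P = code Q.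
Proof. by move=> h; apply: eq_bigl => i; rewrite h. Qed.

Lemma code_split (P Q : pred nat) :
  code P = (code (fun i => P i && Q i) + code (fun i => P i && ~~ Q i))%N.
Proof. by rewrite /code (bigID (fun i : 'I_n => Q i)). Qed.

Lemma codeE (P : pred nat) :
  code P = from_digits B K (fun j => \sum_(i < n | P i) (ty i == j))%N.
Proof.
rewrite /code /from_digits.
under [RHS]eq_bigr do rewrite big_distrl /=.
rewrite exchange_big /=; apply: eq_bigr => i _.
rewrite (bigD1 (Ordinal (ty_lt (ltn_ord i)))) //= eqxx mul1n big1 ?addn0 // => j.
by rewrite -val_eqE eq_sym /= => /negbTE ->.
Qed.

Lemma count_lt (P : pred nat) j : (\sum_(i < n | P i) (ty i == j) < B)%N.
Proof.
rewrite ltnS -[X in (_ <= X)%N](card_ord n) -sum1_card big_mkcond leq_sum // => i _.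
by case: (P i); case: (ty i == j).
Qed.

Lemma digit_code (P : pred nat) j : (j < K)%N ->
  digit B (code P) j = (\sum_(i < n | P i) (ty i == j))%N.
Proof. by move=> hj; rewrite codeE digit_from_digits // => i _; exact: count_lt. Qed.

Lemma code_lt (P : pred nat) : (code P < B ^ K)%N.
Proof. by rewrite codeE from_digits_lt // => i _; exact: count_lt. Qed.

Lemma digit_sum_code (P : pred nat) : digit_sum B K (code P) = (\sum_(i < n | P i) 1)%N.
Proof.
rewrite /digit_sum.
under eq_bigr => j _ do rewrite digit_code //.
rewrite exchange_big /=; apply: eq_bigr => i _.
rewrite (bigD1 (Ordinal (ty_lt (ltn_ord i)))) //= eqxx big1 // => j.
by rewrite -val_eqE eq_sym /= => /negbTE ->.
Qed.

Lemma digit_val_code (P : pred nat) : digit_val (code P) = \sum_(i < n | P i) v (ty i).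
Proof.
rewrite /digit_val.
under eq_bigr => j _ do rewrite digit_code // natr_sum big_distrl /=.
rewrite exchange_big /=; apply: eq_bigr => i _.
rewrite (bigD1 (Ordinal (ty_lt (ltn_ord i)))) //= eqxx mul1r big1 ?addr0 // => j.
by rewrite -val_eqE eq_sym /= => /negbTE ->; rewrite mul0r.
Qed.

Lemma digitwise_le_code (P Q : pred nat) :
  digitwise_le B K (code (fun i => P i && Q i)) (code P).
Proof.
move=> j hj; rewrite !digit_code // [X in (_ <= X)%N](bigID (fun i : 'I_n => Q i)) /=.
exact: leq_addr.
Qed.

Lemma social_cost_code m (w : 'I_n -> R) (d : 'I_m -> R) (A : assignment n m) (a : nat -> nat) :
  (forall i : 'I_n, w i = v (ty i)) -> (forall l : 'I_m, d l = dv l) ->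
  (forall i : 'I_n, a i = A i) ->
  social_cost w d A = \sum_(k < m) group_cost k (code (fun i => a i == k)).
Proof.
move=> hw hd ha; rewrite /social_cost (partition_big A xpredT) //=.
apply: eq_bigr => k _; rewrite /group_cost digit_sum_code digit_val_code -hd.
rewrite (eq_bigr (fun=> d k * \sum_(i < n | a i == k) v (ty i))); last first.
  move=> i /eqP ->; rewrite /load; congr (_ * _).
  by apply: eq_big => [j|j _]; rewrite ?ha ?hw.
rewrite -big_distrr /=; congr (_ * _); rewrite natr_sum big_distrl /=.
by apply: eq_big => [i|i _]; rewrite ?ha ?mul1r.
Qed.

Section LowerBound.
Variables (m : nat) (F : nat -> nat -> R).
Hypothesis F0 : forall c, (c < B ^ K)%N -> F 0 c = group_cost 0 c.
Hypothesis Fle : forall l c x, (0 < l < m)%N -> (c < B ^ K)%N -> (x < B ^ K)%N ->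
  digitwise_le B K x c -> F l c <= F l.-1 (c - x) + group_cost l x.

(** Induction on the last resource: the tasks that [b] sends there form one admissible group [x], so
    [Fle] applies, and the remaining tasks use only lower resources. The set [P] is arbitrary so
    that these tasks can be removed. *)
Lemma dp_lower_bound (b : nat -> nat) l (P : pred nat) : (l < m)%N ->
  (forall i, (i < n)%N -> P i -> (b i <= l)%N) ->
  F l (code P) <= \sum_(k < l.+1) group_cost k (code (fun i => P i && (b i == k))).
Proof.
elim: l P => [|l IH] P lm hb.
  rewrite F0 ?code_lt // big_ord_recl big_ord0 addr0.
  rewrite (@eq_code (fun i => P i && (b i == 0%N)) P) // => i hi.
  by have := hb i hi; case: (P i) => //= /(_ isT); rewrite leqn0.
set x := code (fun i => P i && (b i == l.+1)).
have := Fle (_ : 0 < l.+1 < m)%N (code_lt P) (code_lt _) (digitwise_le_code P (fun i => b i == l.+1)).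
rewrite -/x lm => /(_ isT) /le_trans -> //.
rewrite big_ord_recr /= lerD2r.
have -> : (code P - x = code (fun i => P i && (b i != l.+1)))%N.
  by rewrite (code_split P (fun i => b i == l.+1)) addKn.
apply: le_trans (IH _ (ltnW lm) _) _.
  move=> i hi /andP[Pi ne]; have := hb i hi Pi.
  by rewrite leq_eqVlt (negbTE ne).
rewrite le_eqVlt; apply/orP; left; apply/eqP; apply: eq_bigr => k _.
congr (group_cost _ _); apply: eq_code => i hi.
have := ltn_ord k; case: (P i) => //= kl; case: eqP => //= ->.
by rewrite gtn_eqF.
Qed.

End LowerBound.

Lemma digit_code_from (P : pred nat) i t : (i < n)%N -> (t < K)%N ->
  digit B (code (fun j => (i <= j)%N && P j)) t =
  ((P i && (ty i == t)) + digit B (code (fun j => (i < j)%N && P j)) t)%N.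
Proof.
move=> hi ht; rewrite !digit_code //.
rewrite (bigID (pred1 (Ordinal hi))) /=; congr (_ + _)%N.
  case Pi: (P i).
    rewrite (big_pred1 (Ordinal hi)) // => j /=.
    by rewrite -val_eqE /=; case: eqP => [->|]; rewrite ?andbF // leqnn Pi.
  by rewrite big1 // => j /andP[/andP[_ Pj] /eqP e]; rewrite e /= Pi in Pj.
apply: eq_bigl => j; rewrite -val_eqE /=; case: (P j); rewrite ?andbF // !andbT.
by rewrite ltn_neqAle eq_sym andbC.
Qed.

(** The demand [r] stays digitwise below the supply of eligible tasks not yet scanned, which keeps
    the greedy choice from getting stuck. Taking task [i] lowers the same digit of demand and supply
    by one. *)
Lemma greedy_take (P : pred nat) i r : (i < n)%N -> (r < B ^ K)%N -> P i ->
  digitwise_le B K r (code (fun j => (i <= j)%N && P j)) ->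
  digitwise_le B K (B ^ ty i) r -> (B ^ ty i <= r)%N ->
  digitwise_le B K (r - B ^ ty i) (code (fun j => (i < j)%N && P j)).
Proof.
move=> hi hr Pi le1 le2 ler j hj.
rewrite (@digit_sub _ B_gt1 K) //; last exact: leq_ltn_trans hr.
by rewrite (digitX B_gt1 (ty_lt hi) hj) eq_sym leq_subLR; have := le1 j hj; rewrite digit_code_from // Pi.
Qed.

(** An eligible task is passed over only when the digit of [r] at its type is zero, so losing it
    from the supply does no harm. *)
Lemma greedy_skip (P : pred nat) i r : (i < n)%N ->
  (P i -> ~ digitwise_le B K (B ^ ty i) r) ->
  digitwise_le B K r (code (fun j => (i <= j)%N && P j)) ->
  digitwise_le B K r (code (fun j => (i < j)%N && P j)).
Proof.
move=> hi nle le1 j hj; have := le1 j hj; rewrite digit_code_from //.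
case Pi: (P i) => //; case: (eqVneq (ty i) j) => [e|ne] //= _.
suff -> : digit B r j = 0%N by [].
apply/eqP/negPn/negP => nz; apply: nle => // t ht.
rewrite (digitX B_gt1 (ty_lt hi) ht); case: eqP => // ->.
by rewrite e lt0n.
Qed.

(** Once every task is scanned the supply is empty, which forces the demand to zero. *)
Lemma greedy_end (P : pred nat) r : (r < B ^ K)%N ->
  digitwise_le B K r (code (fun j => (n <= j)%N && P j)) -> r = 0%N.
Proof.
move=> hr le; rewrite -(from_digitsK B_gt1 hr) /from_digits big1 // => j _.
have := le j (ltn_ord j); rewrite digit_code // big1 ?leqn0 => [/eqP -> //|i].
by rewrite leqNgt ltn_ord.
Qed.

End Coding.

(** * The program *)

Definition task_count := NGet 0 (NConst 0).
Definition resource_count := NGet 0 (NConst 1).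

(* Natural arrays: 1 assignment, 2 task codes, 3 digit sums, 4 optimal choices;
   5-13 hold scalars.  Real arrays: 0 weights, 1 delays, 2 weighted digit sums,
   3 optimal costs. *)

Definition find_type :=
  For 6 (NConst 0) (Var 5)
    (If (TReq (RGet 0 (Var 6)) (RGet 0 (Var 5))) (SetN 2 (Var 5) (NGet 2 (Var 6))) Skip).

Definition next_power := NMul (Var 7) (NAdd task_count (NConst 1)).

(** Subtracting the power of the new weight removes one task of that weight and leads to a code
    whose entries are already known. *)
Definition extend_tables :=
  For 6 (Var 7) next_power
    (Seq (SetN 3 (Var 6) (NAdd (NGet 3 (NSub (Var 6) (Var 7))) (NConst 1)))
         (SetR 2 (Var 6) (RAdd (RGet 2 (NSub (Var 6) (Var 7))) (RGet 0 (Var 5))))).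

Definition classify :=
  For 5 (NConst 0) task_count
    (Seq (SetN 2 (Var 5) (Var 7))
    (Seq find_type
    (Seq (If (TNeq (NGet 2 (Var 5)) (Var 7))
             (Seq extend_tables (SetN 7 (NConst 0) next_power)) Skip)
         (SetN 8 (NConst 0) (NAdd (Var 8) (NGet 2 (Var 5))))))).

(* Digit sums are additive exactly when no carry occurs, so this compares [x] and
   [y] digit by digit. *)
Definition fits x y :=
  TAnd (TNot (TNlt y x))
       (TNeq (NAdd (NGet 3 (NSub y x)) (NGet 3 x)) (NGet 3 y)).

Definition cost_of l x := RMul (RGet 1 l) (RMul (ROfN (NGet 3 x)) (RGet 2 x)).

Definition first_row :=
  For 10 (NConst 0) (Var 7) (SetR 3 (Var 10) (cost_of (NConst 0) (Var 10))).

Definition split_cost :=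
  RAdd (RGet 3 (NSub (NSub (Var 13) (Var 7)) (Var 11))) (cost_of (Var 9) (Var 11)).

Definition best_split :=
  For 11 (NConst 0) (Var 7)
    (If (TAnd (fits (Var 11) (Var 10)) (TRlt split_cost (RGet 3 (Var 13))))
        (Seq (SetN 4 (Var 13) (Var 11)) (SetR 3 (Var 13) split_cost)) Skip).

(** The empty group always fits, so it serves as the first candidate and no infinite initial cost is
    required. *)
Definition fill_row :=
  For 10 (NConst 0) (Var 7)
    (Seq (SetN 13 (NConst 0) (NAdd (NMul (Var 9) (Var 7)) (Var 10)))
    (Seq (SetN 4 (Var 13) (NConst 0))
    (Seq (SetR 3 (Var 13) (RAdd (RGet 3 (NSub (Var 13) (Var 7))) (cost_of (Var 9) (NConst 0))))
         best_split))).

Definition fill_table := For 9 (NConst 1) resource_count fill_row.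

(** In array 1 the value 0 stands both for unassigned and for resource 0, so whatever the other
    resources leave over goes to resource 0 without a pass of its own. *)
Definition distribute :=
  For 5 (NConst 0) task_count
    (If (TAnd (TNeq (NGet 1 (Var 5)) (NConst 0)) (fits (NGet 2 (Var 5)) (Var 12)))
        (Seq (SetN 1 (Var 5) (Var 9))
             (SetN 12 (NConst 0) (NSub (Var 12) (NGet 2 (Var 5))))) Skip).

(** The counter runs upwards from 1, so the resource [m - Var 13] descends from [m - 1] to 1. *)
Definition reconstruct :=
  For 13 (NConst 1) resource_count
    (Seq (SetN 9 (NConst 0) (NSub resource_count (Var 13)))
    (Seq (SetN 11 (NConst 0) (NGet 4 (NAdd (NMul (Var 9) (Var 7)) (Var 8))))
    (Seq (SetN 12 (NConst 0) (Var 11))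
    (Seq distribute
         (SetN 8 (NConst 0) (NSub (Var 8) (Var 11))))))).

Definition program :=
  Seq (SetN 7 (NConst 0) (NConst 1))
  (Seq classify (Seq first_row (Seq fill_table reconstruct))).

(** * Correctness of the classification of weights and of the digit tables *)

Section Classify.
Variables (R : realType) (n : nat).
Hypothesis n_gt0 : (0 < n)%N.
Notation B := n.+1.
Let B_gt1 : (1 < B)%N. Proof. by []. Qed.

Definition tables_upto (U : seq R) (s : state R) lim :=
  forall c, (c < lim)%N ->
    nmem s 3 c = digit_sum B (size U) c /\
    rmem s 2 c = digit_val n (size U) (nth 0 U) c.

Lemma digit_sum_addX K c : (B ^ K <= c < B ^ K.+1)%N ->
  digit_sum B K.+1 c = (digit_sum B K.+1 (c - B ^ K)).+1.
Proof.
move=> /andP[h1 h2]; rewrite -{1}(subnK h1) /digit_sum !big_ord_recr /=.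
rewrite (digit_addX_eq B_gt1); last by rewrite subnK.
rewrite addnS; congr (_ + _).+1.
by apply: eq_bigr => j _; rewrite digit_addX_lt.
Qed.

Lemma digit_val_addX (v : nat -> R) K c : (B ^ K <= c < B ^ K.+1)%N ->
  digit_val n K.+1 v c = digit_val n K.+1 v (c - B ^ K) + v K.
Proof.
move=> /andP[h1 h2]; rewrite -{1}(subnK h1) /digit_val !big_ord_recr /=.
rewrite (digit_addX_eq B_gt1); last by rewrite subnK.
rewrite -natr1 mulrDl mul1r addrA; congr (_ + _ + _).
by apply: eq_bigr => j _; rewrite digit_addX_lt.
Qed.

Lemma digit_sum_small K c : (c < B ^ K)%N -> digit_sum B K.+1 c = digit_sum B K c.
Proof. by move=> h; rewrite /digit_sum big_ord_recr /= digit_small // addn0. Qed.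

Lemma digit_val_small (U : seq R) u c : (c < B ^ size U)%N ->
  digit_val n (size U).+1 (nth 0 (rcons U u)) c = digit_val n (size U) (nth 0 U) c.
Proof.
move=> h; rewrite /digit_val big_ord_recr /= digit_small // mul0r addr0.
by apply: eq_bigr => j _; rewrite nth_rcons ltn_ord.
Qed.

(** The scan does not stop at a match: all earlier tasks of the same weight carry the same power, so
    copying it again changes nothing. Without a match the provisional power [B ^ size U]
    survives. *)
Lemma find_typeP s (U : seq R) (i : nat) :
  (i < n)%N -> nmem s 5 0 = i ->
  nmem s 2 i = (B ^ size U)%N ->
  (forall k, (k < i)%N -> nmem s 2 k = (B ^ index (rmem s 0 k) U)%N) ->
  wp find_type s (40 * n + 40) (fun s' =>
    nmem s' 2 i = (if rmem s 0 i \in mkseq (rmem s 0) i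
                  then B ^ index (rmem s 0 i) U else B ^ size U)%N /\
    forall k, k != i -> nmem s' 2 k = nmem s 2 k).
Proof.
move=> hi ei e0 ek.
apply: (@wp_for _ _ _ _ _ _ 0 i 14 _ (fun k s' =>
    nmem s' 2 i = (if rmem s 0 i \in mkseq (rmem s 0) k
                  then B ^ index (rmem s 0 i) U else B ^ size U)%N /\
    forall k, k != i -> nmem s' 2 k = nmem s 2 k)) => //.
- by move=> s' fr /=; rewrite fr.1.
- move=> k s' /= ki fr ek' [e1 e2].
  apply: wp_loop_free => //=.
  rewrite !ek' !(fr.1 5 0 isT) !(fr.2 0 _ isT) ei mkseqS mem_rcons in_cons.
  case: eqP => [e|ne] /=; last first.
    by rewrite eq_sym; move/eqP/negbTE: ne => ->.
  rewrite e eqxx /upd !eqxx /=; split.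
    by rewrite ?ek' e2 ?ek ?e // ltn_eqF.
  by move=> j ji; rewrite (negbTE ji) e2.
by rewrite /=; lia.
Qed.

Lemma extend_tablesP s (U : seq R) M :
  nmem s 0 0 = n -> nmem s 7 0 = (B ^ size U)%N ->
  tables_upto U s (B ^ size U) -> (B ^ (size U).+1 <= M)%N ->
  wp extend_tables s (60 * M + 60) (fun s' =>
    tables_upto (rcons U (rmem s 0 (nmem s 5 0))) s' (B ^ (size U).+1)).
Proof.
move=> en epw tab hM.
set u := rmem s 0 (nmem s 5 0).
apply: (@wp_for _ _ _ _ _ _ (B ^ size U) (B ^ (size U).+1) 30 _
   (fun k s' => tables_upto (rcons U u) s' k)) => //.
- by rewrite leq_exp2l.
- by move=> s' fr /=; rewrite !fr.1 // en epw addn1 expnS mulnC.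
- by move=> c hc; rewrite size_rcons digit_sum_small // digit_val_small //; exact: tab.
- move=> k s' ki fr ek' I.
  apply: wp_loop_free => //= c; rewrite ltnS leq_eqVlt => /orP[/eqP ->|ck].
    rewrite /= /upd !eqxx /= !ek' !eqxx !(fr.1 7 0 isT) (fr.1 5 0 isT) (fr.2 0 _ isT) epw -/u size_rcons.
    have [|e1 e2] := I (k - B ^ size U)%N.
      by have := expn_gt0 B (size U); lia.
    rewrite e1 e2 size_rcons (digit_sum_addX ki) (digit_val_addX _ ki) addn1.
    by rewrite nth_rcons ltnn eqxx.
  by rewrite /= /upd !eqxx /= !ek' (ltn_eqF ck); exact: I.
- by rewrite /=; lia.
Qed.


(** [U] is a ghost list of the distinct weights met so far; memory records position [j] of it only
    as the power [B ^ j]. *)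
Definition classified (U : seq R) (w : nat -> R) i (s : state R) :=
  [/\ uniq U /\ U =i mkseq w i, nmem s 7 0 = (B ^ size U)%N,
      tables_upto U s (B ^ size U),
      forall k, (k < i)%N -> nmem s 2 k = (B ^ index (w k) U)%N
    & nmem s 8 0 = (\sum_(k < i) B ^ index (w k) U)%N].

(** Every task is charged a full table extension of order [B ^ alpha]. This is crude but harmless,
    as [n * B ^ alpha] is below [B ^ (2 * alpha)]. The bound on [size U] keeps each extension within
    [B ^ alpha]. *)
Lemma classifyP s (w : nat -> R) alpha :
  nmem s 0 0 = n -> rmem s 0 =1 w -> nmem s 7 0 = 1%N -> nmem s 8 0 = 0%N ->
  nmem s 3 0 = 0%N -> rmem s 2 0 = 0 ->
  (forall U : seq R, uniq U -> {subset U <= mkseq w n} -> (size U <= alpha)%N) ->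
  (0 < alpha)%N ->
  wp classify s (400 * (n * B ^ alpha) + 20) (fun s' => exists U, classified U w n s').
Proof.
move=> en ew epw eT e3 e2 hU al0.
have nM : (B <= B ^ alpha)%N by rewrite -{1}[B]expn1 leq_exp2l.
set M := (B ^ alpha)%N in nM *.
apply: (@wp_for _ _ _ _ _ _ 0 n (110 * M + 200) _
   (fun k s' => exists U, classified U w k s')) => //.
- by move=> s' fr /=; rewrite fr.1.
- exists [::]; split=> //.
    by move=> [|c] // _; rewrite e3 e2 /digit_sum /digit_val !big_ord0.
  by rewrite big_ord0.
- move=> i s0 /= hi fr ei [U [[uU mU] p0 tab ek T0]].
  apply: (@wp_step _ _ _ _ 10 (110 * M + 190)) => //; last by lia.
  set s1 := den _ _.
  have e1 : nmem s1 2 i = (B ^ size U)%N by rewrite /s1 /= ei /upd !eqxx.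
  have ne1 k : k != i -> nmem s1 2 k = nmem s0 2 k.
    by rewrite /s1 /= ei /upd /= => /negbTE ->.
  have w1 k : rmem s1 0 k = w k by rewrite /s1 /= fr.2.
  have find := @find_typeP s1 U i hi ei e1.
  apply: (wp_seq_frame (b2 := 70 * M + 140) (find _)); last by lia.
    by move=> k ki; rewrite ne1 ?ltn_eqF // w1 ek.
  move=> s2 f2 [e2' ne2]; rewrite w1 in e2'.
  have emk : (w i \in mkseq (rmem s1 0) i) = (w i \in U).
    by rewrite mU; congr (_ \in _); apply: eq_map.
  rewrite {}emk in e2'.
  have tab2 : tables_upto U s2 (B ^ size U).
    by move=> c hc; rewrite (f2.1 3) // (f2.2 2) // /s1 /= /upd /=; exact: tab.
  have i2 : nmem s2 5 0 = i by rewrite f2.1 // /s1 /= /upd /= ei.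
  have p2 : nmem s2 7 0 = (B ^ size U)%N by rewrite f2.1.
  have n0 : nmem s2 0 0 = n by rewrite f2.1 // /s1 /= /upd /= fr.1.
  have w2 : rmem s2 0 i = w i by rewrite f2.2.
  set U' := if w i \in U then U else rcons U (w i).
  apply: (@wp_seq_frame _ _ _ _ (70 * M + 130) 10 _ (fun s3 =>
    nmem s3 7 0 = (B ^ size U')%N /\ tables_upto U' s3 (B ^ size U'))); last by lia.
    apply: (@wp_if _ _ _ _ _ (70 * M + 120)) => /=; last by lia.
      rewrite i2 p2 e2' => eqp.
      have niU : w i \notin U.
        apply/negP => iU; move: eqp; rewrite iU eqn_exp2l //.
        by apply/negP; rewrite ltn_eqF // index_mem.
      rewrite /U' (negbTE niU) size_rcons.
      have hM : (B ^ (size U).+1 <= M)%N.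
        rewrite leq_exp2l // -(size_rcons U (w i)); apply: hU.
          by rewrite rcons_uniq niU.
        move=> x; rewrite mem_rcons in_cons mU => /orP[/eqP ->|/mapP[j]].
          by apply/mapP; exists i; rewrite // mem_iota.
        rewrite mem_iota => /= ji ->; apply/mapP; exists j => //.
        by rewrite mem_iota /= (leq_trans ji) // ltnW.
      apply: (wp_seq_frame (b2 := 20) (extend_tablesP n0 p2 tab2 hM)) => [s3 f3|]; last by lia.
      rewrite i2 w2 => tab3.
      apply: wp_loop_free => //=; split.
        by rewrite /upd /= !f3.1 // n0 p2 addn1 expnS mulnC.
      by move=> c hc; have := tab3 c hc; rewrite /= /upd /=.
    rewrite i2 p2 e2' => eqp.
    have iU : w i \in U by apply: contraNT eqp => /negbTE ->.
    by rewrite /U' iU; apply: wp_loop_free => //=; lia.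
  move=> s3 f3 [p3 tab3].
  have e3' k : (k < n)%N -> nmem s3 2 k = nmem s2 2 k by move=> _; rewrite f3.1.
  have iU' k : (k <= i)%N -> index (w k) U' = if (k == i) && (w i \notin U) then size U else index (w k) U.
    rewrite /U' leq_eqVlt; case: eqP => [->|_] /=; case: ifP => //= iU.
      by move=> _; rewrite -cats1 index_cat iU /= eqxx addn0.
    move=> ki; rewrite -cats1 index_cat mU.
    case: ifP => // /mapP[]; by exists k; rewrite // mem_iota.
  apply: wp_loop_free => //; exists U'; split.
  - split.
      by rewrite /U'; case: ifP => // iU; rewrite rcons_uniq iU.
    move=> x; rewrite mkseqS mem_rcons in_cons -mU /U'; case: ifP => iU.
      by case: eqP => // ->; rewrite iU.
    by rewrite mem_rcons in_cons.
  - by [].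
  - by move=> c hc; have := tab3 c hc; rewrite /= /upd /=.
  - move=> k; rewrite ltnS => ki /=; rewrite /upd /= e3' ?(leq_ltn_trans ki) // iU' //.
    case: eqP => [->|/eqP ne] /=; first by rewrite e2'; case: ifP.
    rewrite ne2 // ne1 // ek // ltn_neqAle ne ki //.
  - rewrite /= /upd /= big_ord_recr /= (f3.1 8) // (f2.1 8) // (f3.1 5) // i2 e3' // e2' iU' // eqxx /=.
    congr (_ + _)%N; last by case: ifP.
    rewrite /s1 /= /upd /= T0; apply: eq_bigr => k _; have ki := ltn_ord k.
    by rewrite iU' ?(ltnW ki) // ltn_eqF.
- have nnM : (n <= n * M)%N by rewrite leq_pmulr //; lia.
  by rewrite /=; lia.
Qed.

End Classify.

Lemma den_if (R : realType) (s : state R) b c1 c2 :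
  den (If b c1 c2) s = if teval s b then den c1 s else den c2 s.
Proof. by []. Qed.

(** * The dynamic programming table *)

Section FillTable.
Variables (R : realType) (n m K : nat) (v dv : nat -> R).
Notation B := n.+1.
Hypothesis n_gt0 : (0 < n)%N.
Let B_gt1 : (1 < B)%N. Proof. by []. Qed.
Notation N := (B ^ K)%N.
Notation gc := (group_cost n K v dv).
Let N_gt0 : (0 < N)%N. Proof. by rewrite expn_gt0. Qed.

Definition tabulated (s : state R) :=
  [/\ nmem s 0 0 = n /\ nmem s 0 1 = m, nmem s 7 0 = N,
      forall c, (c < N)%N ->
        nmem s 3 c = digit_sum B K c /\ rmem s 2 c = digit_val n K v c
    & forall l, rmem s 1 l = dv l].

Lemma tabulated_frame c s s' :
  ~~ has (fun a => a \in nwrites c) [:: 0; 3; 7]%N ->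
  ~~ has (fun a => a \in rwrites c) [:: 1; 2]%N ->
  frame c s s' -> tabulated s -> tabulated s'.
Proof.
rewrite /= !orbF !negb_or => /and3P[h0 h3 h7] /andP[h1 h2] fr [[e0 e1] e7 et ed].
split=> [|||l]; rewrite ?fr.1 ?fr.2 // => c' hc; rewrite fr.1 // fr.2 //; exact: et.
Qed.

Lemma fitsP s ex ey y : tabulated s -> neval s ey = y -> (y < N)%N ->
  reflect (digitwise_le B K (neval s ex) y /\ (neval s ex < N)%N) (teval s (fits ex ey)).
Proof.
move=> [_ _ tab _] <- hy /=; rewrite -leqNgt.
have -> : ((neval s ex <= neval s ey)%N &&
  (nmem s 3 (neval s ey - neval s ex) + nmem s 3 (neval s ex) == nmem s 3 (neval s ey))%N) =
  ((neval s ex <= neval s ey)%N && (digit_sum B K (neval s ey - neval s ex) +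
     digit_sum B K (neval s ex) == digit_sum B K (neval s ey))%N).
  case: leqP => //= xy; rewrite !(proj1 (tab _ _)) //.
    exact: leq_ltn_trans hy.
  exact: leq_ltn_trans (leq_subr _ _) hy.
exact: digitwise_leP.
Qed.

Lemma cost_ofE s el ex : tabulated s -> (neval s ex < N)%N ->
  reval s (cost_of el ex) = gc (neval s el) (neval s ex).
Proof.
move=> [_ _ tab ed] hx /=; rewrite ed /group_cost.
by have [-> ->] := tab _ hx.
Qed.

Lemma digitwise_le_leq x y : (y < N)%N -> (x < N)%N -> digitwise_le B K x y -> (x <= y)%N.
Proof. by move=> hy hx le; have /digitwise_leP/andP[] := conj le hx. Qed.

(** The Bellman equation is stated about the memory itself. The minimality clause feeds the lower
    bound; the other three drive the reconstruction. *)
Definition entry (s : state R) l c :=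
  let prev x := rmem s 3 (l.-1 * N + (c - x)) + gc l x in
  let x := nmem s 4 (l * N + c) in
  [/\ digitwise_le B K x c, (x < N)%N, rmem s 3 (l * N + c) = prev x
    & forall x', (x' < N)%N -> digitwise_le B K x' c ->
        rmem s 3 (l * N + c) <= prev x'].

Definition filled (s : state R) lim :=
  (forall c, (c < N)%N -> rmem s 3 c = gc 0 c) /\
  forall l c, (0 < l)%N -> (c < N)%N -> (l * N + c < lim)%N -> entry s l c.

(** The table is stored row by row, and an entry refers only to itself and to the preceding row,
    hence never to a cell at or beyond [lim]. *)
Lemma filled_ext s s' lim : (N <= lim)%N ->
  (forall j, (j < lim)%N -> nmem s' 4 j = nmem s 4 j) ->
  (forall j, (j < lim)%N -> rmem s' 3 j = rmem s 3 j) ->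
  filled s lim -> filled s' lim.
Proof.
move=> hN e4 e3 [f0 f]; split=> [c hc|l c l0 hc hl]; first by rewrite e3 ?f0 // (leq_trans hc).
have [h1 h2 h3 h4] := f l c l0 hc hl.
have hp x : (l.-1 * N + (c - x) < lim)%N.
  apply: leq_ltn_trans hl; rewrite leq_add ?leq_subr // leq_mul2r leq_pred orbT //.
rewrite /entry e4 // e3 //; split=> //; first by rewrite e3.
by move=> x' hx' le; rewrite e3 //; exact: h4.
Qed.

Lemma first_rowP s : tabulated s ->
  wp first_row s (50 * N + 20) (fun s' => filled s' N).
Proof.
move=> T.
apply: (@wp_for _ _ _ _ _ _ 0 N 30 _
  (fun k s' => forall c, (c < k)%N -> rmem s' 3 c = gc 0 c)) => //.
- by move=> s' fr /=; rewrite fr.1 //; case: T.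
- move=> k s' /= kN fr ek I.
  have T' : tabulated s' by apply: tabulated_frame fr T.
  apply: wp_loop_free => //= c; rewrite ltnS leq_eqVlt => /orP[/eqP ->|ck].
    have := @cost_ofE s' (NConst 0) (Var 10) T'; rewrite /= ek => /(_ kN) ->.
    by rewrite /upd !eqxx.
  by rewrite /= /upd /= ek (ltn_eqF ck) I.
- move=> s' fr I; split=> // l c l0 hc.
  by case: l l0 => // l _; rewrite mulSn -addnA ltnNge leq_addr.
- by rewrite /=; lia.
Qed.

Lemma best_splitP s l c : tabulated s -> (0 < l)%N -> (c < N)%N ->
  nmem s 9 0 = l -> nmem s 10 0 = c -> nmem s 13 0 = (l * N + c)%N ->
  filled s (l * N + c) -> nmem s 4 (l * N + c) = 0%N ->
  rmem s 3 (l * N + c) = rmem s 3 (l.-1 * N + c) + gc l 0 ->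
  wp best_split s (100 * N + 20) (fun s' => filled s' (l * N + c).+1).
Proof.
move=> T l0 hc e9 e10 e13 fl ch0 F0.
set idx := (l * N + c)%N in e13 fl ch0 F0 *.
have idxE : idx = (N + l.-1 * N + c)%N by rewrite /idx -{1}(prednK l0) mulSn.
pose prev x := rmem s 3 (l.-1 * N + (c - x)) + gc l x.
pose Inv k (s' : state R) :=
  [/\ forall j, j != idx -> nmem s' 4 j = nmem s 4 j /\ rmem s' 3 j = rmem s 3 j,
      digitwise_le B K (nmem s' 4 idx) c /\ (nmem s' 4 idx < N)%N,
      rmem s' 3 idx = prev (nmem s' 4 idx)
    & forall x, (x < k)%N -> (x < N)%N -> digitwise_le B K x c -> rmem s' 3 idx <= prev x].
(* Candidates are read from the preceding row, so updating the current cell does not disturb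
   them. *)
have prev_lt x : (l.-1 * N + (c - x) != idx)%N by rewrite ltn_eqF // idxE; lia.
apply: (@wp_for _ _ _ _ _ _ 0 N 80 _ Inv) => //.
- by move=> s' fr /=; rewrite fr.1 //; case: T.
- split=> //; rewrite ch0 //; last by rewrite /prev subn0.
  by split=> // j hj; rewrite digit_zero.
- move=> k s' /= kN fr ek [Ie [Il IN] If Im].
  have T' : tabulated s' by apply: tabulated_frame fr T.
  have f9 : nmem s' 9 0 = l by rewrite fr.1.
  have f10 : nmem s' 10 0 = c by rewrite fr.1.
  have f13 : nmem s' 13 0 = idx by rewrite fr.1.
  have f7 : nmem s' 7 0 = N by case: T'.
  apply: wp_loop_free => //.
  have hf := @fitsP s' (Var 11) (Var 10) c T' f10 hc.
  (* For [k > c] the index in [split_cost] need not be the intended one, but then [fits] fails and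
     the value is discarded. *)
  have hs : (k <= c)%N -> reval s' split_cost = prev k.
    move=> kc; have := @cost_ofE s' (Var 9) (Var 11) T'.
    rewrite /= ek f9 => /(_ kN) ->; rewrite f13 f7.
    have -> : (idx - N - k = l.-1 * N + (c - k))%N by rewrite idxE -addnA addKn addnBA.
    by rewrite (proj2 (Ie _ (prev_lt k))).
  have testE : teval s' (TAnd (fits (Var 11) (Var 10)) (TRlt split_cost (RGet 3 (Var 13)))) =
     teval s' (fits (Var 11) (Var 10)) && (reval s' split_cost < rmem s' 3 idx).
    by rewrite /= f13.
  rewrite den_if testE; case: hf => [[le _]|nle]; last first.
    rewrite andFb; split=> // x; rewrite ltnS leq_eqVlt => /orP[/eqP ->|] => [xN xc|]; last exact: Im.
    by case: nle; rewrite /= ek.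
  rewrite /= ek in le.
  have kc : (k <= c)%N by exact: digitwise_le_leq.
  rewrite andTb hs //; case: ltP => [lt|ge]; last first.
    split=> // x; rewrite ltnS leq_eqVlt => /orP[/eqP ->|] // ; exact: Im.
  have -> : den (Seq (SetN 4 (Var 13) (Var 11)) (SetR 3 (Var 13) split_cost)) s' =
      setr (setn s' 4 idx k) 3 idx (prev k).
    by rewrite -hs // -{1}f13 /= /upd /= f13 ek.
  split; rewrite /= /upd /= ?eqxx //.
    by move=> j ji; rewrite (negbTE ji); exact: Ie.
  move=> x; rewrite ltnS leq_eqVlt => /orP[/eqP ->|xk] xN xc //.
  exact: le_trans (ltW lt) (Im _ xk xN xc).
- move=> s' fr [Ie [Il IN] If Im].
  have NI : (N <= idx)%N by rewrite idxE -addnA leq_addr.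
  have [g0 g] : filled s' idx.
    apply: filled_ext fl => // j ji; have := Ie j; rewrite ltn_eqF // => /(_ isT) []; done.
  split=> // l' c' l'0 hc'; rewrite ltnS leq_eqVlt => /orP[/eqP e|]; last exact: g.
  have [le ce] : l' = l /\ c' = c.
    have := congr1 (fun x : nat => x %/ N)%N e; rewrite /idx /= !divnMDl // !divn_small // !addn0 => le.
    by split=> //; apply: (@addnI (l * N)); rewrite -{1}le.
  rewrite le ce /entry -/idx; split=> //.
    by rewrite If (proj2 (Ie _ (prev_lt _))).
  move=> x hx hxc; rewrite (proj2 (Ie _ (prev_lt _))); exact: Im.
- by rewrite /=; lia.
Qed.

Lemma fill_rowP s l : tabulated s -> (0 < l)%N -> nmem s 9 0 = l -> filled s (l * N) ->
  wp fill_row s (200 * (N * N)) (fun s' => filled s' (l.+1 * N)).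
Proof.
move=> T l0 e9 fl.
apply: (@wp_for _ _ _ _ _ _ 0 N (100 * N + 60) _ (fun c s' => filled s' (l * N + c))) => //.
- by move=> s' fr /=; rewrite fr.1 //; case: T.
- by rewrite addn0.
- move=> c s0 /= hc fr ec I.
  have T0 : tabulated s0 by apply: tabulated_frame fr T.
  have f9 : nmem s0 9 0 = l by rewrite fr.1.
  have f7 : nmem s0 7 0 = N by case: T0.
  set idx := (l * N + c)%N in I *.
  have idxE : idx = (N + l.-1 * N + c)%N by rewrite /idx -{1}(prednK l0) mulSn.
  pose s1 := den (SetN 13 (NConst 0) (NAdd (NMul (Var 9) (Var 7)) (Var 10))) s0.
  apply: (@wp_step _ _ _ _ 10 (100 * N + 50)) => //; last by lia.
  rewrite -/s1.
  have h13 : nmem s1 13 0 = idx by rewrite /s1 /= /upd /= f9 f7 ec.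
  pose s2 := den (SetN 4 (Var 13) (NConst 0)) s1.
  apply: (@wp_step _ _ _ _ 5 (100 * N + 45)) => //; last by lia.
  rewrite -/s2.
  pose s3 := den (SetR 3 (Var 13) (RAdd (RGet 3 (NSub (Var 13) (Var 7))) (cost_of (Var 9) (NConst 0)))) s2.
  apply: (@wp_step _ _ _ _ 25 (100 * N + 20)) => //; last by lia.
  rewrite -/s3.
  have T2 : tabulated s2 by case: T0.
  have T3 : tabulated s3 by case: T2.
  have s3E j : rmem s3 3 j = if j == idx then rmem s0 3 (l.-1 * N + c) + gc l 0 else rmem s0 3 j.
    have c2 : reval s2 (cost_of (Var 9) (NConst 0)) = gc l 0.
      by rewrite cost_ofE //; congr gc; exact: f9.
    have h13' : nmem s2 13 0 = idx := h13.
    have h7' : nmem s2 7 0 = N := f7.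
    change (upd (rmem s2) 3 (nmem s2 13 0)
      (rmem s2 3 (nmem s2 13 0 - nmem s2 7 0)%N + reval s2 (cost_of (Var 9) (NConst 0))) 3 j =
      if j == idx then rmem s0 3 (l.-1 * N + c)%N + gc l 0 else rmem s0 3 j).
    rewrite c2 h13' h7'.
    by have -> : (idx - N = l.-1 * N + c)%N by rewrite idxE -addnA addKn.
  have s3E' j : nmem s3 4 j = if j == idx then 0%N else nmem s0 4 j.
    change (upd (nmem s1) 4 (nmem s1 13 0) 0%N 4 j = if j == idx then 0%N else nmem s0 4 j).
    by rewrite h13.
  rewrite (addnS (l * N)); apply: best_splitP => //.
  + apply: filled_ext I => [|j ji|j ji]; first by rewrite idxE -addnA leq_addr.
      by rewrite s3E' ltn_eqF.
    by rewrite s3E ltn_eqF.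
  + by rewrite s3E' eqxx.
  + rewrite !s3E eqxx ltn_eqF // idxE; lia.
- by move=> s' _; rewrite mulSn addnC.
- have : (N <= N * N)%N by rewrite leq_pmulr.
  by rewrite /=; lia.
Qed.

Lemma fill_tableP s : (0 < m)%N -> tabulated s -> filled s N ->
  wp fill_table s (220 * (m * (N * N)) + 20) (fun s' => filled s' (m * N)).
Proof.
move=> m0 T fl.
apply: (@wp_for _ _ _ _ _ _ 1 m (200 * (N * N)) _ (fun l s' => filled s' (l * N))) => //.
- by move=> s' fr /=; rewrite fr.1 //; case: T => [[]].
- by rewrite mul1n.
- move=> l s' /andP[l0 lm] fr el I; apply: fill_rowP => //.
  by apply: tabulated_frame fr T.
- have h : (m <= m * (N * N))%N by rewrite leq_pmulr // muln_gt0 N_gt0.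
  have : ((m - 1) * (200 * (N * N) + 2 + 10) <= m * (200 * (N * N) + 2 + 10))%N.
    by rewrite leq_mul2r leq_subr orbT.
  by rewrite /=; lia.
Qed.

End FillTable.

(** * Reading an assignment off the table *)

Section Reconstruct.
Variables (R : realType) (n m K : nat) (ty : nat -> nat) (v dv : nat -> R).
Notation B := n.+1.
Hypothesis n_gt0 : (0 < n)%N.
Hypothesis ty_lt : forall i, (i < n)%N -> (ty i < K)%N.
Let B_gt1 : (1 < B)%N. Proof. by []. Qed.
Notation N := (B ^ K)%N.
Notation gc := (group_cost n K v dv).
Notation tcode := (code n ty).

Lemma code_add (P : pred nat) i : (i < n)%N -> ~~ P i ->
  tcode (fun j => (j == i) || P j) = (B ^ ty i + tcode P)%N.
Proof.
move=> hi nP; rewrite (code_split _ _ _ (fun j => j == i)); congr (_ + _)%N.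
  rewrite /code (big_pred1 (Ordinal hi)) // => j.
  by rewrite /= -val_eqE /=; case: eqP; rewrite ?andbF.
apply: eq_code => j _; case: eqP => [->|] /=; first by rewrite (negbTE nP).
by rewrite andbT.
Qed.

(** The invariant splits [r] into the part already picked and the remaining demand, which lies
    digitwise below the unassigned tasks ahead. That supply can be expressed in the initial memory
    because tasks not yet scanned are unchanged. *)
Lemma distributeP s l r : tabulated n m K v dv s -> (0 < l)%N ->
  nmem s 9 0 = l -> nmem s 12 0 = r -> (r < N)%N ->
  (forall i, (i < n)%N -> nmem s 2 i = (B ^ ty i)%N) ->
  (forall i, (i < n)%N -> nmem s 1 i != l) ->
  digitwise_le B K r (tcode (fun j => nmem s 1 j == 0%N)) ->
  wp distribute s (70 * n + 20) (fun s' =>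
    (forall j, (j < n)%N -> nmem s' 1 j = nmem s 1 j \/ nmem s 1 j = 0%N /\ nmem s' 1 j = l)
    /\ tcode (fun j => nmem s' 1 j == l) = r).
Proof.
move=> T l0 e9 e12 rN e2 nl le.
pose Inv i (s' : state R) :=
  [/\ forall j, (i <= j)%N -> nmem s' 1 j = nmem s 1 j,
      forall j, (j < n)%N -> nmem s' 1 j = nmem s 1 j \/ nmem s 1 j = 0%N /\ nmem s' 1 j = l,
      (nmem s' 12 0 + tcode (fun j => nmem s' 1 j == l))%N = r
    & digitwise_le B K (nmem s' 12 0) (tcode (fun j => (i <= j)%N && (nmem s 1 j == 0%N)))].
apply: (@wp_for _ _ _ _ _ _ 0 n 50 _ Inv) => //.
- by move=> s' fr /=; rewrite fr.1 //; case: T => [[]].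
- split=> //; first by move=> j _; left.
    rewrite e12 /code big1 ?addn0 // => j /eqP e.
    by case/eqP: (nl j (ltn_ord j)).
  by rewrite e12.
- move=> i s' /= hi fr ei [Ie Io Ir Il].
  have T' : tabulated n m K v dv s' by apply: tabulated_frame fr T.
  have f9 : nmem s' 9 0 = l by rewrite fr.1.
  have f2 : nmem s' 2 i = (B ^ ty i)%N by rewrite fr.1 // e2.
  set r' := nmem s' 12 0 in Ir Il.
  have r'N : (r' < N)%N by apply: leq_ltn_trans rN; rewrite -Ir leq_addr.
  apply: wp_loop_free => //; rewrite den_if.
  have f2' : neval s' (NGet 2 (Var 5)) = (B ^ ty i)%N by rewrite /= ei f2.
  have hf := @fitsP _ n m K v dv n_gt0 s' (NGet 2 (Var 5)) (Var 12) r' T' erefl r'N.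
  rewrite f2' in hf.
  have testE b : teval s' (TAnd (TNeq (NGet 1 (Var 5)) (NConst 0)) b) =
      (nmem s 1 i == 0%N) && teval s' b by rewrite /= ei Ie.
  rewrite testE.
  case: (boolP (_ && _)) => [/andP[P /hf [lei iN]]|nP].
    have -> : den (Seq (SetN 1 (Var 5) (Var 9)) (SetN 12 (NConst 0) (NSub (Var 12) (NGet 2 (Var 5))))) s'
      = setn (setn s' 1 i l) 12 0 (r' - B ^ ty i)%N.
      by rewrite /= /upd /= ei f9 f2.
    have leir : (B ^ ty i <= r')%N by apply: digitwise_le_leq lei.
    split.
    + move=> j ij; rewrite /= /upd /= gtn_eqF //; exact: Ie (ltnW ij).
    + move=> j hj; rewrite /= /upd /=; case: eqP => [->|_]; last exact: Io.
      by right; split=> //; exact/eqP.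
    + rewrite -Ir /= /upd /= -[in RHS](subnK leir) -addnA; congr (_ + _)%N.
      rewrite -code_add //; last by rewrite Ie // nl.
      by apply: eq_code => j _; case: (eqVneq j i) => _ /=; rewrite ?eqxx.
    + rewrite /= /upd /=; exact: (greedy_take (P := fun j => nmem s 1 j == 0%N) n_gt0 ty_lt).
  split=> //.
  + by move=> j ij; exact: Ie (ltnW ij).
  + apply: (greedy_skip (P := fun j => nmem s 1 j == 0%N) n_gt0 ty_lt) => // P0 lei.
    move: nP; rewrite P0 andTb => /hf; apply; split=> //.
    rewrite ltn_exp2l //; exact: ty_lt.
- move=> s' fr [Ie Io Ir Il]; split=> //.
  have r'N : (nmem s' 12 0 < N)%N by apply: leq_ltn_trans rN; rewrite -Ir leq_addr.
  by rewrite -Ir (greedy_end n_gt0 ty_lt r'N Il) add0n.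
- by rewrite /=; lia.
Qed.

(** The conserved quantity is the cost of the groups already given out plus the table entry for the
    remaining code; each recorded choice moves one [group_cost] from the entry to the sum. At
    counter [q] the next resource is [m - q]. *)
Lemma reconstructP s : (0 < m)%N -> tabulated n m K v dv s ->
  filled n K v dv s (m * N) ->
  (forall i, (i < n)%N -> nmem s 2 i = (B ^ ty i)%N) ->
  (forall i, nmem s 1 i = 0%N) ->
  nmem s 8 0 = tcode xpredT ->
  wp reconstruct s (m * (70 * n + 80) + 20) (fun s' =>
    (forall i, (i < n)%N -> (nmem s' 1 i < m)%N) /\
    \sum_(k < m) gc k (tcode (fun i => nmem s' 1 i == k)) =
      rmem s 3 (m.-1 * N + tcode xpredT)).
Proof.
move=> m0 T [fl0 fl] e2 e1 e8.
pose Inv q (s' : state R) :=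
  [/\ nmem s' 8 0 = tcode (fun j => nmem s' 1 j == 0%N),
      forall j, (j < n)%N -> nmem s' 1 j = 0%N \/ (m - q < nmem s' 1 j < m)%N
    & \sum_((m - q).+1 <= k < m) gc k (tcode (fun j => nmem s' 1 j == k)) +
       rmem s 3 ((m - q) * N + nmem s' 8 0)%N = rmem s 3 (m.-1 * N + tcode xpredT)].
apply: (@wp_for _ _ _ _ _ _ 1 m (70 * n + 60) _ Inv) => //.
- by move=> s' fr /=; rewrite fr.1 //; case: T => [[]].
- split.
  + by rewrite e8; apply: eq_code => j _; rewrite e1.
  + by move=> j _; left.
  + by rewrite big_geq ?add0r ?e8 ?subn1 // prednK.
- move=> q s0 /= /andP[q0 qm] fr eq [I8 I1 IS].
  have T0 : tabulated n m K v dv s0 by apply: tabulated_frame fr T.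
  set l := (m - q)%N in I1 IS.
  set t := nmem s0 8 0 in I8 IS.
  have l0 : (0 < l)%N by rewrite subn_gt0.
  have lm : (l < m)%N by rewrite /l; lia.
  have tN : (t < N)%N by rewrite I8 code_lt.
  have ltm : (l * N + t < m * N)%N.
    apply: (@leq_trans (l.+1 * N)); last by rewrite leq_mul2r lm orbT.
    by rewrite mulSn addnC ltn_add2r.
  have [] := fl l t l0 tN ltm; set x := nmem s 4 _ => xle xN Fe _.
  pose s1 := den (SetN 9 (NConst 0) (NSub resource_count (Var 13))) s0.
  apply: (@wp_step _ _ _ _ 10 (70 * n + 50)) => //; last by lia.
  rewrite -/s1.
  have a9 : nmem s1 9 0 = l by rewrite /s1 /= /upd /= eq; case: T0 => [[_ ->]].
  pose s2 := den (SetN 11 (NConst 0) (NGet 4 (NAdd (NMul (Var 9) (Var 7)) (Var 8)))) s1.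
  apply: (@wp_step _ _ _ _ 12 (70 * n + 38)) => //; last by lia.
  rewrite -/s2.
  have a7 : nmem s1 7 0 = N by case: T0.
  have a11 : nmem s2 11 0 = x.
    change (nmem s1 4 (nmem s1 9 0 * nmem s1 7 0 + t)%N = x).
    by rewrite a9 a7; exact: fr.1.
  pose s3 := den (SetN 12 (NConst 0) (Var 11)) s2.
  apply: (@wp_step _ _ _ _ 5 (70 * n + 33)) => //; last by lia.
  rewrite -/s3.
  have T3 : tabulated n m K v dv s3 by case: T0.
  have ne i : (i < n)%N -> nmem s3 1 i != l.
    move=> hi; apply/eqP => e; have := I1 i hi; change (nmem s0 1 i = l) in e.
    by rewrite e ltnn => -[e0|//]; rewrite e0 in l0.
  have ty3 i : (i < n)%N -> nmem s3 2 i = (B ^ ty i)%N.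
    by move=> hi; change (nmem s0 2 i = (B ^ ty i)%N); rewrite fr.1 // e2.
  have xle3 : digitwise_le B K x (tcode (fun j => nmem s3 1 j == 0%N)).
    by rewrite I8 in xle.
  have D := @distributeP s3 l x T3 l0 a9 a11 xN ty3 ne xle3.
  apply: (wp_seq_frame (b2 := 10) D); last by lia.
  move=> s4 f4 [d1 d2]; apply: wp_loop_free => //.
  have h8 : nmem s4 8 0 = t by rewrite f4.1.
  have h11 : nmem s4 11 0 = x by rewrite f4.1.
  have -> : den (SetN 8 (NConst 0) (NSub (Var 8) (Var 11))) s4 = setn s4 8 0 (t - x)%N.
    by rewrite /= h8 h11.
  have d1' j : (j < n)%N -> nmem s4 1 j = nmem s0 1 j \/ nmem s0 1 j = 0%N /\ nmem s4 1 j = l.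
    exact: d1.
  have eqS : (m - q.+1 = l.-1)%N by rewrite /l subnS.
  have code0 : (t - x)%N = tcode (fun j => nmem s4 1 j == 0%N).
    rewrite I8 (code_split _ _ _ (fun j => nmem s4 1 j == l)).
    have -> : tcode (fun i => (nmem s0 1 i == 0%N) && (nmem s4 1 i == l)) = x.
      rewrite -d2; apply: eq_code => j hj; case: (d1' j hj) => [->|[-> ->]]; last by rewrite eqxx.
      have /negbTE := ne j hj; change (nmem s3 1 j) with (nmem s0 1 j) => ->.
      by rewrite andbF.
    rewrite addKn; apply: eq_code => j hj; case: (d1' j hj) => [->|[-> ->]].
      have := ne j hj; change (nmem s3 1 j) with (nmem s0 1 j) => ->.
      by rewrite andbT.
    by rewrite !eqxx /= gtn_eqF.
  split; rewrite ?eqS.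
  + exact: code0.
  + move=> j hj; change (nmem s4 1 j = 0%N \/ (l.-1 < nmem s4 1 j < m)%N).
    case: (d1' j hj) => [->|[_ ->]]; last by right; rewrite prednK // leqnn.
    by case: (I1 j hj) => [->|/andP[h1 h2]]; [left|right; rewrite h2 andbT; lia].
  + change (\sum_(l.-1.+1 <= k < m) gc k (tcode (fun j => nmem s4 1 j == k)) +
      rmem s 3 (l.-1 * N + (t - x))%N = rmem s 3 (m.-1 * N + tcode xpredT)).
    rewrite prednK // big_ltn // d2 -IS Fe -/x.
    (* Groups of higher resources are untouched, since [distribute] reassigns only tasks whose value
       was 0. *)
    rewrite [X in _ + X + _](_ : _ = \sum_(l.+1 <= k < m) gc k (tcode (fun j => nmem s0 1 j == k))).
      by rewrite -addrA addrC -addrA.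
    rewrite !big_nat; apply: eq_bigr => k /andP[lk km]; congr gc; apply: eq_code => j hj.
    case: (d1' j hj) => [->//|[-> ->]].
    by rewrite ltn_eqF // ltn_eqF // (ltn_trans l0).
- move=> s' fr [I8 I1 IS]; split.
    by move=> i hi; case: (I1 i hi) => [->|/andP[]].
  (* At [q = m] the remaining entry lies in row 0, where it is the cost of the tasks whose value is
     still 0. *)
  rewrite -IS subnn mul0n add0n fl0; last by rewrite I8 code_lt.
  by rewrite -(big_mkord xpredT (fun k => gc k (tcode (fun i => nmem s' 1 i == k)))) big_ltn // addrC I8.
- rewrite /=.
  have : ((m - 1) * (70 * n + 60 + 2 + 10) <= m * (70 * n + 60 + 2 + 10))%N.
    by rewrite leq_mul2r leq_subr orbT.
  by lia.
Qed.

End Reconstruct.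

(** * Total running time and optimality *)

Lemma vec_memE (R : realType) k (x : 'I_k -> R) (i : 'I_k) : vec_mem x i = x i.
Proof. by rewrite /vec_mem valK. Qed.

Lemma size_distinct_weights (R : realType) (alpha n : nat) (w : 'I_n -> R) (U : seq R) :
  (exists w' : 'I_alpha -> R, forall i : 'I_n, exists j : 'I_alpha, w i = w' j) ->
  uniq U -> {subset U <= mkseq (vec_mem w) n} -> (size U <= alpha)%N.
Proof.
move=> [w' hw'] uU sU; rewrite -[leqRHS]card_ord -(size_codom w').
apply: uniq_leq_size => // x /sU /mapP[i]; rewrite mem_iota /= => hi ->.
have [j e] := hw' (Ordinal hi).
by rewrite (vec_memE w (Ordinal hi)) e codom_f.
Qed.

(** Every summand is at most a constant times [X], and these constants add up to less than 1000. The
    factor [4 ^ alpha] comes from [n + 1 <= 2 * n], valid for positive [n], raised to the power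
    [2 * alpha]. *)
Lemma total_cost_bound (alpha n m N : nat) : (0 < n)%N -> (0 < m)%N -> (0 < alpha)%N ->
  (N <= n.+1 ^ alpha)%N ->
  (3 + (400 * (n * n.+1 ^ alpha) + 20 + (50 * N + 20 + (220 * (m * (N * N)) + 20 +
     (m * (70 * n + 80) + 20)))) <= 1000 * 4 ^ alpha * (m * n ^ (2 * alpha)))%N.
Proof.
move=> n0 m0 a0; set M := (n.+1 ^ alpha)%N => NM.
have nM : (n < M)%N by rewrite -[n.+1]expn1 leq_exp2l.
set X := (m * (M * M))%N.
have X1 : (M * M <= X)%N by rewrite leq_pmull.
have X2 : (n * M <= M * M)%N by rewrite leq_mul2r (ltnW nM) orbT.
have X3 : (M <= M * M)%N by rewrite leq_pmull //; lia.
have X4 : (m * (N * N) <= X)%N by rewrite leq_mul2l leq_mul ?orbT.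
have X5 : (m * n <= X)%N by rewrite leq_mul2l (leq_trans (ltnW nM)) ?orbT.
have X6 : (m <= X)%N by rewrite leq_pmulr //; lia.
have hX : (X <= 4 ^ alpha * (m * n ^ (2 * alpha)))%N.
  rewrite mulnCA leq_mul2l; apply/orP; right.
  have -> : (4 ^ alpha * n ^ (2 * alpha) = (2 * n) ^ alpha * (2 * n) ^ alpha)%N.
    by rewrite expnM -!expnMn -mulnn; congr (_ ^ _)%N; lia.
  by rewrite leq_mul // leq_exp2r //; lia.
apply: (@leq_trans (1000 * X)); last by rewrite -mulnA leq_mul2l hX orbT.
by lia.
Qed.

Theorem theorem5p3 (R : realType) (alpha : nat) (halpha : (0 < alpha)%N) :
  exists (P : cmd) (c : nat),
    forall (n m : nat) (w : 'I_n -> R) (d : 'I_m -> R),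
      (0 < n)%N -> (0 < m)%N ->
      (forall i : 'I_n, 1 <= w i) ->
      (forall l : 'I_m, 0 < d l) ->
      (forall k l : 'I_m, (k <= l)%N -> d k <= d l) ->
      (exists w' : 'I_alpha -> R, forall i : 'I_n, exists j : 'I_alpha, w i = w' j) ->
      exists (s : state R) (t : nat) (A : assignment n m),
        [/\ exec P (input w d) s t,
            (t <= c * (m * n ^ (2 * alpha)))%N,
            outputs s A
          & optimal w d A].
Proof.
(* The program is the same for all [alpha], which enters only the time bound. *)
exists program, (1000 * 4 ^ alpha)%N => n m w d n0 m0 _ _ _ hw'.
suff [s [t [E l [A [oA optA]]]]] : wp program (input w d)
    (1000 * 4 ^ alpha * (m * n ^ (2 * alpha))) (fun s =>
    exists A : assignment n m, outputs s A /\ optimal w d A).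
  by exists s, t, A.
pose wv := vec_mem w; pose dv := vec_mem d.
apply: (@wp_step _ _ _ _ 3 (1000 * 4 ^ alpha * (m * n ^ (2 * alpha)) - 3)) => //; last first.
  (* The number of distinct weights is not yet known; the bound at [N = 0] suffices to see that the
     subtraction from the budget does not truncate. *)
  by have := total_cost_bound n0 m0 halpha (leq0n _); lia.
set s1 := den _ _.
have cl := @classifyP _ n n0 s1 wv alpha erefl (frefl _) erefl erefl erefl erefl
  (fun U => size_distinct_weights hw') halpha.
apply: (wp_seq_frame (b2 := 1000 * 4 ^ alpha * (m * n ^ (2 * alpha)) - 3 - (400 * (n * n.+1 ^ alpha) + 20)) cl);
  last first.
  by have := total_cost_bound n0 m0 halpha (leq0n _); lia.
move=> s2 f2 [U [[uU mU] e7 tab e2 e8]].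
set K := size U in e7 tab; pose v := nth 0 U; pose ty i := index (wv i) U.
have ty_lt i : (i < n)%N -> (ty i < K)%N.
  by move=> hi; rewrite index_mem mU; apply/mapP; exists i; rewrite // mem_iota.
have vE (i : 'I_n) : w i = v (ty i).
  by rewrite /v /ty nth_index -?index_mem ?ty_lt // /wv vec_memE.
have KA : (K <= alpha)%N.
  by apply: (size_distinct_weights hw' uU) => x; rewrite mU.
have NM : (n.+1 ^ K <= n.+1 ^ alpha)%N by rewrite leq_exp2l.
have bound := total_cost_bound n0 m0 halpha NM.
set N := (n.+1 ^ K)%N in NM bound e7 tab.
have T2 : tabulated n m K v dv s2.
  by split=> //; [rewrite !f2.1|move=> l; rewrite f2.2].
apply: (wp_seq_frame (b2 := 220 * (m * (N * N)) + 20 + (m * (70 * n + 80) + 20)) (first_rowP n0 T2));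
  last by lia.
move=> s3 f3 fl3.
have T3 : tabulated n m K v dv s3 by apply: tabulated_frame f3 T2.
apply: (wp_seq_frame (fill_tableP n0 m0 T3 fl3)) (leqnn _) => s4 f4 fl4.
have T4 : tabulated n m K v dv s4 by apply: tabulated_frame f4 T3.
have e2' i : (i < n)%N -> nmem s4 2 i = (n.+1 ^ ty i)%N.
  by move=> hi; rewrite f4.1 // f3.1 // e2.
have e1' i : nmem s4 1 i = 0%N by rewrite f4.1 // f3.1 // f2.1.
have e8' : nmem s4 8 0 = code n ty xpredT by rewrite f4.1 // f3.1.
have [s5 [t5 [E5 l5 [a_lt costE]]]] := reconstructP n0 ty_lt m0 T4 fl4 e2' e1' e8'.
exists s5, t5; split=> //.
pose A : assignment n m := [ffun i : 'I_n => insubd (Ordinal m0) (nmem s5 1 i)].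
have AE (i : 'I_n) : nmem s5 1 i = A i by rewrite ffunE val_insubd a_lt.
exists A; split=> // C.
pose b i := if insub i is Some j then C j : nat else 0%N.
have bE (i : 'I_n) : b i = C i by rewrite /b valK.
have dE l : d l = dv l by rewrite /dv vec_memE.
(* Both costs become sums of [group_cost]; the one of [A] is exactly the last table entry, which
   [dp_lower_bound] compares with the one of [C]. *)
rewrite (social_cost_code n0 ty_lt vE dE AE) (social_cost_code n0 ty_lt vE dE bE) costE.
have [F0 Fl] := fl4.
have b_le i : (i < n)%N -> xpredT i -> (b i <= m.-1)%N.
  by move=> hi _; rewrite (bE (Ordinal hi)) -ltnS prednK.
have lb := @dp_lower_bound R n K ty v dv n0 ty_lt m
  (fun l c => rmem s4 3 (l * N + c)%N) _ _ b m.-1 xpredT _ b_le.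
rewrite prednK // in lb; apply: lb => //.
move=> l c x /andP[l0 lm] hc hx le.
have ltm : (l * N + c < m * N)%N.
  apply: (@leq_trans (l.+1 * N)); last by rewrite leq_mul2r lm orbT.
  by rewrite mulSn addnC ltn_add2r.
by have [_ _ _] := Fl l c l0 hc ltm; apply.
Qed.
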